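(* For every $p \in [1,\infty)$, the multiplier algebra $M(T_2^p)$ is isometrically isomorphic (as a Banach algebra) to $\mathbb{C}^2$ with pointwise multiplication and the supremum norm. In particular, for all $p,q \in [1,\infty)$, $M(T_2^p)$ is an $L^q$-operator algebra that is nondegenerately representable on $\ell_2^q$ (that is, there is an isometric nondegenerate representation of $M(T_2^p)$ on $\ell_2^q$).
   Context: For a Banach space $E$, $\mathcal{L}(E)$ is the Banach algebra of bounded linear maps $E\to E$; $\ell_d^p=\ell^p(\{1,\ldots,d\})$ (complex scalars). $T_2^p = \left\{\begin{pmatrix}0&z\\0&0\end{pmatrix} : z\in\mathbb{C}\right\}\subset \mathcal{L}(\ell_2^p)$, with the operator norm and matrix multiplication. A representation of a Banach algebra $A$ on a Banach space $E$ is a continuous algebra homomorphism $\pi\colon A\to\mathcal{L}(E)$; it is isometric if $\|\pi(a)\|=\|a\|$ for all $a\in A$, and nondegenerate if $\operatorname{span}\{\pi(a)\xi : a\in A,\ \xi\in E\}$ is dense in $E$. $A$ is an $L^q$-operator algebra if there is a measure space $(\Omega,\mu)$ and an isometric representation of $A$ on $L^q(\Omega,\mu)$. Multiplier algebra of a Banach algebra $A$: $M(A)$ is the set of pairs $(L,R)$ with $L,R\in\mathcal{L}(A)$ such that $L(ab)=L(a)b$, $R(ab)=aR(b)$ and $aL(b)=R(a)b$ for all $a,b\in A$, regarded as a unital Banach subalgebra of $\mathcal{L}(A)\times\mathcal{L}(A)^{\mathrm{op}}$, i.e. with product $(L,R)(L',R')=(LL',R'R)$ and norm $\|(L,R)\|=\max\{\|L\|,\|R\|\}$.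 *)

(* Defs.v *)
From HB Require Import structures.
From mathcomp Require Import all_boot all_order all_algebra.
From mathcomp Require Import all_classical all_reals all_analysis.
From mathcomp Require Import measurable_realfun complex.

Set Implicit Arguments.
Unset Strict Implicit.
Unset Printing Implicit Defensive.
Import Order.TTheory GRing.Theory Num.Theory.
Import numFieldNormedType.Exports.
Import Normc.

Local Open Scope classical_set_scope.
Local Open Scope complex_scope.
Local Open Scope ring_scope.

(* Possibly non-unital algebras with a submultiplicative norm. Completeness is
   not part of the structure: none of the notions below depends on it, and a
   Banach algebra is used through its underlying normed algebra. *)
HB.mixin Record NormedModule_isNormedAlgebra (K : numFieldType) A
    & NormedModule K A := {
  amul : A -> A -> A;
  amulA : associative amul;
  amulDl : left_distributive amul +%R;
  amulDr : right_distributive amul +%R;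
  amulZl : forall (c : K) (x y : A), amul (c *: x) y = c *: amul x y;
  amulZr : forall (c : K) (x y : A), amul x (c *: y) = c *: amul x y;
  amul_norm : forall x y : A, `|amul x y| <= `|x| * `|y|
}.

#[short(type="normedAlgType")]
HB.structure Definition NormedAlgebra (K : numFieldType) :=
  {A of NormedModule K A & NormedModule_isNormedAlgebra K A}.

Lemma amul0r (K : numFieldType) (A : normedAlgType K) (x : A) : amul 0 x = 0.
Proof. by rewrite -[X in amul X _](scale0r 0) amulZl scale0r. Qed.

Lemma amulr0 (K : numFieldType) (A : normedAlgType K) (x : A) : amul x 0 = 0.
Proof. by rewrite -[X in amul _ X](scale0r 0) amulZr scale0r. Qed.

Section Scalars.
Variable K : numFieldType.

HB.instance Definition _ := @NormedModule_isNormedAlgebra.Build K K^o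
  (fun x y : K => x * y) (@mulrA K) (@mulrDl K) (@mulrDr K)
  (fun c x y : K => esym (mulrA c x y)) (fun c x y : K => mulrCA x c y)
  (fun x y : K => eq_ind_r (fun z => z <= `|x| * `|y|) (lexx _) (normrM x y)).

End Scalars.

(* The library's norm on A * B is the maximum of the two norms. *)
Section Product.
Variables (K : numFieldType) (A B : normedAlgType K).

Definition prod_amul (x y : A * B) : A * B := (amul x.1 y.1, amul x.2 y.2).

Fact prod_amulA : associative prod_amul.
Proof. by move=> x y z; rewrite /prod_amul/= !amulA. Qed.
Fact prod_amulDl : left_distributive prod_amul +%R.
Proof. by move=> x y z; rewrite /prod_amul/= !amulDl. Qed.
Fact prod_amulDr : right_distributive prod_amul +%R.
Proof. by move=> x y z; rewrite /prod_amul/= !amulDr. Qed.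
Fact prod_amulZl (c : K) x y : prod_amul (c *: x) y = c *: prod_amul x y.
Proof. by rewrite /prod_amul/= !amulZl. Qed.
Fact prod_amulZr (c : K) x y : prod_amul x (c *: y) = c *: prod_amul x y.
Proof. by rewrite /prod_amul/= !amulZr. Qed.
Fact prod_amul_norm x y : `|prod_amul x y| <= `|x| * `|y|.
Proof.
rewrite /prod_amul !prod_normE/= comparable_ge_max ?real_comparable//.
apply/andP; split; apply: (le_trans (amul_norm _ _)); apply: ler_pM => //;
  by rewrite comparable_le_max ?real_comparable// lexx ?orbT.
Qed.

HB.instance Definition _ := @NormedModule_isNormedAlgebra.Build K (A * B)%type
  prod_amul prod_amulA prod_amulDl prod_amulDr prod_amulZl prod_amulZr
  prod_amul_norm.

End Product.

Definition opalg (A : Type) : Type := A.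

Section Opposite.
Variables (K : numFieldType) (A : normedAlgType K).

HB.instance Definition _ := NormedModule.copy (opalg A) A.

Definition op_amul (x y : opalg A) : opalg A := amul (y : A) (x : A).

Fact op_amulA : associative op_amul.
Proof. by move=> x y z; rewrite /op_amul amulA. Qed.
Fact op_amulDl : left_distributive op_amul +%R.
Proof. by move=> x y z; exact: (@amulDr K A). Qed.
Fact op_amulDr : right_distributive op_amul +%R.
Proof. by move=> x y z; exact: (@amulDl K A). Qed.
Fact op_amulZl (c : K) x y : op_amul (c *: x) y = c *: op_amul x y.
Proof. exact: (@amulZr K A). Qed.
Fact op_amulZr (c : K) x y : op_amul x (c *: y) = c *: op_amul x y.
Proof. exact: (@amulZl K A). Qed.
Fact op_amul_norm x y : `|op_amul x y| <= `|x| * `|y|.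
Proof. by rewrite mulrC; exact: (@amul_norm K A). Qed.

HB.instance Definition _ := @NormedModule_isNormedAlgebra.Build K (opalg A)
  op_amul op_amulA op_amulDl op_amulDr op_amulZl op_amulZr op_amul_norm.

End Opposite.

Record subalgebra (K : numFieldType) (A : normedAlgType K) := Subalgebra {
  subalg_pred :> {pred A};
  subalg_submod : submod_closed subalg_pred;
  subalg_mul : {in subalg_pred &, forall x y, amul x y \in subalg_pred}
}.

Section SubalgType.
Variables (K : numFieldType) (A : normedAlgType K) (S : subalgebra A).

HB.instance Definition _ := GRing.isSubmodClosed.Build K A
  (subalg_pred S) (subalg_submod S).

Record subalg := Subalg {subalg_val :> A; subalg_valP : subalg_val \in subalg_pred S}.

HB.instance Definition _ := [isSub for subalg_val].
HB.instance Definition _ := [Choice of subalg by <:].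
HB.instance Definition _ := [SubChoice_isSubLmodule of subalg by <:].

Let sub_norm (x : subalg) : K := `|val x|.

Fact subalg_normD x y : sub_norm (x + y) <= sub_norm x + sub_norm y.
Proof. by rewrite /sub_norm raddfD ler_normD. Qed.
Fact subalg_normZ (c : K) x : sub_norm (c *: x) = `|c| * sub_norm x.
Proof. by rewrite /sub_norm linearZ normrZ. Qed.
Fact subalg_norm_eq0 x : sub_norm x = 0 -> x = 0.
Proof. by move/normr0_eq0 => x0; apply: val_inj; rewrite x0 raddf0. Qed.

HB.instance Definition _ := @Lmodule_isNormed.Build K subalg
  sub_norm subalg_normD subalg_normZ subalg_norm_eq0.

Definition subalg_amul (x y : subalg) : subalg :=
  Subalg (subalg_mul (subalg_valP x) (subalg_valP y)).

Fact subalg_amulA : associative subalg_amul.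
Proof. by move=> x y z; apply: val_inj; rewrite /= amulA. Qed.
Fact subalg_amulDl : left_distributive subalg_amul +%R.
Proof. by move=> x y z; apply: val_inj; rewrite /= amulDl. Qed.
Fact subalg_amulDr : right_distributive subalg_amul +%R.
Proof. by move=> x y z; apply: val_inj; rewrite /= amulDr. Qed.
Fact subalg_amulZl (c : K) x y : subalg_amul (c *: x) y = c *: subalg_amul x y.
Proof. by apply: val_inj; rewrite /= amulZl. Qed.
Fact subalg_amulZr (c : K) x y : subalg_amul x (c *: y) = c *: subalg_amul x y.
Proof. by apply: val_inj; rewrite /= amulZr. Qed.
Fact subalg_amul_norm x y : `|subalg_amul x y| <= `|x| * `|y|.
Proof. exact: amul_norm. Qed.

HB.instance Definition _ := @NormedModule_isNormedAlgebra.Build K subalg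
  subalg_amul subalg_amulA subalg_amulDl subalg_amulDr subalg_amulZl
  subalg_amulZr subalg_amul_norm.

End SubalgType.

Section RealNorm.
Context {R : realType} {E : normedModType R[i]}.

(* The norm of a complex normed space takes its values in R[i]; it is real. *)
Definition rnorm (x : E) : R := complex.Re `|x|.

Lemma rnormE (x : E) : `|x| = (rnorm x)%:C.
Proof. by rewrite /rnorm RRe_real// ger0_real. Qed.

Lemma rnorm_ge0 (x : E) : 0 <= rnorm x.
Proof. by have := normr_ge0 x; rewrite lecE => /andP[]. Qed.

Lemma rnorm_le (x : E) (r : R) : (rnorm x <= r) = (`|x| <= r%:C).
Proof. by rewrite rnormE lecR. Qed.

End RealNorm.

Section BoundedOperators.
Context {R : realType} {E F : normedModType R[i]}.

Definition bounded_linear : {pred E -> F} := [pred f : E -> F |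
  `[< linear f /\ exists M : R, forall x, `|f x| <= M%:C * `|x| >]].

Fact bounded_linear_submod : submod_closed bounded_linear.
Proof.
split.
  apply/asboolP; split => [a x y|]; first by rewrite /= scaler0 addr0.
  by exists 0 => x; rewrite normr0 mul0r.
move=> a f g /asboolP[lf [M Mf]] /asboolP[lg [N Ng]]; apply/asboolP; split.
  move=> b x y; rewrite !fctE/= lf lg !scalerDr !scalerA addrACA.
  by rewrite [a * b]mulrC.
exists (rnorm (a : R[i]^o) * M + N) => x.
rewrite !fctE rmorphD rmorphM/= -rnormE mulrDl -mulrA.
by rewrite (le_trans (ler_normD _ _))// lerD// normrZ ler_wpM2l.
Qed.

HB.instance Definition _ := GRing.isSubmodClosed.Build R[i] (E -> F)
  bounded_linear bounded_linear_submod.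

Record bop := Bop {bop_fun :> E -> F; bopP : bop_fun \in bounded_linear}.

HB.instance Definition _ := [isSub for bop_fun].
HB.instance Definition _ := [Choice of bop by <:].
HB.instance Definition _ := [SubChoice_isSubLmodule of bop by <:].

Fact bop_linear (f : bop) : linear f.
Proof. by have /asboolP[] := bopP f. Qed.

HB.instance Definition _ (f : bop) :=
  GRing.isLinear.Build R[i] E F *:%R (bop_fun f) (bop_linear f).

Lemma bopE (f g : bop) : f =1 g -> f = g.
Proof. by move=> fg; apply: val_inj; apply/funext. Qed.

Definition opnorm (f : bop) : R :=
  sup [set rnorm (f x) | x in [set x | rnorm x <= 1]].

Fact opnorm_has_sup (f : bop) :
  has_sup [set rnorm (f x) | x in [set x | rnorm x <= 1]].
Proof.
split; first by exists (rnorm (f 0)), 0 => //=; rewrite /rnorm normr0.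
have /asboolP[_ [M Mf]] := bopP f.
exists (Num.max M 0) => _ [x /= x1 <-].
rewrite rnorm_le (le_trans (Mf x))// rnormE -rmorphM lecR.
rewrite (@le_trans _ _ (Num.max M 0 * rnorm x))//.
  by rewrite ler_wpM2r ?rnorm_ge0// le_max lexx.
by rewrite ler_piMr// le_max lexx orbT.
Qed.

Lemma opnorm_ub (f : bop) x : rnorm x <= 1 -> rnorm (f x) <= opnorm f.
Proof.
by move=> x1; apply: ub_le_sup; [have [] := opnorm_has_sup f | exists x].
Qed.

Lemma opnorm_le (f : bop) (M : R) :
  (forall x, rnorm x <= 1 -> rnorm (f x) <= M) -> opnorm f <= M.
Proof.
move=> fM; apply: ge_sup; first by have [] := opnorm_has_sup f.
by move=> _ [x /= x1 <-]; exact: fM.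
Qed.

Lemma opnorm_ge0 (f : bop) : 0 <= opnorm f.
Proof.
apply: (le_trans (rnorm_ge0 (f 0))); apply: opnorm_ub.
by rewrite /rnorm normr0.
Qed.

Lemma opnormP (f : bop) x : `|f x| <= (opnorm f)%:C * `|x|.
Proof.
have [->|x0] := eqVneq x 0; first by rewrite linear0 !normr0 mulr0.
have nx0 : `|x| != 0 by rewrite normr_eq0.
have /(opnorm_ub f) : rnorm (`|x|^-1 *: x) <= 1.
  by rewrite rnorm_le normrZ normrV ?unitfE// normr_id mulVf.
rewrite rnorm_le linearZ/= normrZ normrV ?unitfE// normr_id => h.
by rewrite -ler_pdivrMr ?normr_gt0// mulrC.
Qed.

Let nrm (f : bop) : R[i] := (opnorm f)%:C.

Fact nrmD f g : nrm (f + g) <= nrm f + nrm g.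
Proof.
rewrite /nrm -rmorphD lecR; apply: opnorm_le => x x1.
rewrite rnorm_le rmorphD (le_trans (ler_normD _ _))//.
by rewrite lerD// -rnorm_le opnorm_ub.
Qed.

Fact nrmZ_le (c : R[i]) f : nrm (c *: f) <= `|c| * nrm f.
Proof.
have cE : `|c| = (rnorm (c : R[i]^o))%:C by rewrite -rnormE.
rewrite cE /nrm -rmorphM lecR; apply: opnorm_le => x x1.
rewrite rnorm_le rmorphM/= -cE normrZ ler_wpM2l//.
by rewrite -rnorm_le opnorm_ub.
Qed.

Fact nrm_eq0 f : nrm f = 0 -> f = 0.
Proof.
move=> f0; apply: bopE => x; apply/eqP; rewrite -normr_le0.
by rewrite (le_trans (opnormP f x))// -/(nrm f) f0 mul0r.
Qed.

Fact nrmZ (c : R[i]) f : nrm (c *: f) = `|c| * nrm f.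
Proof.
apply/le_anti; rewrite nrmZ_le/=.
have [->|c0] := eqVneq c 0.
  by rewrite normr0 mul0r lecR opnorm_ge0.
rewrite -ler_pdivlMl ?normr_gt0// -normrV ?unitfE//.
by rewrite -[in leLHS](scale1r f) -(mulVf c0) -scalerA nrmZ_le.
Qed.

HB.instance Definition _ := @Lmodule_isNormed.Build R[i] bop
  nrm nrmD nrmZ nrm_eq0.

End BoundedOperators.
Arguments bop {R} E F.

Section OperatorAlgebra.
Context {R : realType} {E : normedModType R[i]}.

Fact bop_comp_subproof (f g : bop E E) :
  (f \o g : E -> E) \in bounded_linear.
Proof.
apply/asboolP; split; first by move=> a x y; rewrite /= !linearP.
exists (opnorm f * opnorm g) => x.
rewrite rmorphM -mulrA (le_trans (opnormP f _))// ler_wpM2l//.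
  by rewrite lecR opnorm_ge0.
exact: opnormP.
Qed.

Definition bop_comp (f g : bop E E) : bop E E := Bop (bop_comp_subproof f g).

Fact bop_compA : associative bop_comp.
Proof. by move=> f g h; apply: bopE. Qed.
Fact bop_compDl : left_distributive bop_comp +%R.
Proof. by move=> f g h; apply: bopE. Qed.
Fact bop_compDr : right_distributive bop_comp +%R.
Proof. by move=> f g h; apply: bopE => x; rewrite /= linearD. Qed.
Fact bop_compZl (c : R[i]) f g : bop_comp (c *: f) g = c *: bop_comp f g.
Proof. by apply: bopE. Qed.
Fact bop_compZr (c : R[i]) f g : bop_comp f (c *: g) = c *: bop_comp f g.
Proof. by apply: bopE => x; rewrite /= linearZ. Qed.
Fact bop_comp_norm f g : `|bop_comp f g| <= `|f| * `|g|.
Proof.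
rewrite -[leRHS](rmorphM (@real_complex R) (opnorm f) (opnorm g)) lecR.
apply: opnorm_le => x x1; rewrite rnorm_le rmorphM.
rewrite (le_trans (opnormP f _))// ler_wpM2l//; first by rewrite lecR opnorm_ge0.
by rewrite -rnorm_le opnorm_ub.
Qed.

HB.instance Definition _ := @NormedModule_isNormedAlgebra.Build R[i] (bop E E)
  bop_comp bop_compA bop_compDl bop_compDr bop_compZl bop_compZr bop_comp_norm.

End OperatorAlgebra.

Section Multipliers.
Context {R : realType} (A : normedAlgType R[i]).

Definition multiplier_pred : {pred bop A A * opalg (bop A A)} :=
  [pred LR : bop A A * opalg (bop A A) |
    let lm : bop A A := LR.1 in let rm : bop A A := LR.2 in
    `[< forall a b : A, [/\ lm (amul a b) = amul (lm a) b,
                            rm (amul a b) = amul a (rm b)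
                          & amul a (lm b) = amul (rm a) b] >]].

Fact multiplier_submod : submod_closed multiplier_pred.
Proof.
split.
  by apply/asboolP => a b /=; rewrite !amul0r !amulr0.
move=> c [L S] [L' S'] /asboolP LS /asboolP LS'; apply/asboolP => a b /=.
have [/= L1 S1 LS1] := LS a b; have [/= L2 S2 LS2] := LS' a b.
split.
- by rewrite !fctE L1 L2 amulDl amulZl.
- by rewrite !fctE S1 S2 amulDr amulZr.
- by rewrite !fctE amulDr amulZr LS1 LS2 amulDl amulZl.
Qed.

Fact multiplier_mul :
  {in multiplier_pred &, forall x y, amul x y \in multiplier_pred}.
Proof.
move=> [L S] [L' S'] /asboolP LS /asboolP LS'; apply/asboolP => a b /=.
split.
- have [/= -> _ _] := LS' a b.
  by have [/= -> _ _] := LS (L' a) b.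
- have [/= _ -> _] := LS a b.
  by have [/= _ -> _] := LS' a (S b).
- have [/= _ _ ->] := LS a (L' b).
  by have [/= _ _ ->] := LS' (S a) b.
Qed.

Definition multiplier_subalgebra : subalgebra (bop A A * opalg (bop A A))%type :=
  Subalgebra multiplier_submod multiplier_mul.

Definition multiplier_algebra : normedAlgType R[i] :=
  subalg multiplier_subalgebra.

End Multipliers.

(* ell^p({1, ..., d}) with complex scalars. The type carries its own p-norm,
   not the library's sup norm on matrices. *)
Section FiniteSequences.
Context {R : realType}.

Lemma minkowski_sum (p : R) d (a b : 'I_d -> R) : 1 <= p ->
  (forall i, 0 <= a i) -> (forall i, 0 <= b i) ->
  (\sum_i (a i + b i) `^ p) `^ p^-1 <=
  (\sum_i a i `^ p) `^ p^-1 + (\sum_i b i `^ p) `^ p^-1.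
Proof.
move=> p1 a0 b0; have p0 : 0 < p := lt_le_trans ltr01 p1.
pose ext (c : 'I_d -> R) k : R := if insub k is Some i then c i else 0.
have NE (c : 'I_d -> R) : (forall i, 0 <= c i) ->
    'N[counting]_p%:E [EFin \o ext c]%E = ((\sum_i c i `^ p) `^ p^-1)%:E.
  move=> c0; rewrite Lnorm_counting//.
  rewrite (nneseries_split 0%N d); last by move=> k _; exact: poweR_ge0.
  rewrite add0n ereal_series_cond eseries0 ?adde0; last first.
    move=> k _ dk /=.
    rewrite /ext insubN /=; last first.
      by rewrite -leqNgt; case/andP: dk.
    by rewrite normr0 powR0// gt_eqF.
  rewrite big_mkord -poweR_EFin -sumEFin; congr poweR; apply: eq_bigr => i _.
  by rewrite /= /ext valK ger0_norm.
have mext c : measurable_fun setT (ext c) by [].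
have := minkowski_EFin counting (mext a) (mext b) p1.
rewrite (_ : (ext a \+ ext b)%R = ext (a \+ b)); last first.
  by apply/funext => k; rewrite /ext /=; case: insubP => //; rewrite addr0.
by rewrite !NE// => i; rewrite addr_ge0.
Qed.

Definition ellp (p : R) of 1 <= p := fun d : nat => 'cV[R[i]]_d.

Section Structure.
Variables (p : R) (p1 : 1 <= p) (d : nat).
Local Notation V := (ellp p1 d).

HB.instance Definition _ := GRing.Lmodule.copy V 'cV[R[i]]_d.

Definition ellp_norm (x : V) : R :=
  (\sum_(i < d) normc (x i ord0) `^ p) `^ p^-1.

Let nrm (x : V) : R[i] := (ellp_norm x)%:C.

Let p_ge0 : 0 <= p := le_trans ler01 p1.
Let p_neq0 : p != 0 := lt0r_neq0 (lt_le_trans ltr01 p1).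

Fact normc_ge0 (z : R[i]) : 0 <= normc z.
Proof. by case: z => a b; exact: sqrtr_ge0. Qed.

Fact ellp_normD x y : nrm (x + y) <= nrm x + nrm y.
Proof.
rewrite /nrm -rmorphD lecR.
apply: le_trans (minkowski_sum p1 _ _); [|move=> i; exact: normc_ge0..].
apply: ge0_ler_powR; rewrite ?invr_ge0// ?nnegrE.
- by apply: sumr_ge0 => i _; exact: powR_ge0.
- by apply: sumr_ge0 => i _; exact: powR_ge0.
- apply: ler_sum => i _; apply: ge0_ler_powR; rewrite ?nnegrE//.
  + exact: normc_ge0.
  + by rewrite addr_ge0// normc_ge0.
  + by rewrite mxE le_normcD.
Qed.

Fact ellp_normZ (c : R[i]) x : nrm (c *: x) = `|c| * nrm x.
Proof.
rewrite [`|c|](_ : _ = (normc c)%:C)// /nrm -rmorphM; congr (_%:C).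
rewrite /ellp_norm; under eq_bigr do rewrite mxE normcM powRM ?normc_ge0//.
rewrite -mulr_sumr powRM ?powR_ge0//; last first.
  by apply: sumr_ge0 => i _; exact: powR_ge0.
by rewrite -powRrM mulfV// powRr1// normc_ge0.
Qed.

Fact ellp_norm_eq0 x : nrm x = 0 -> x = 0.
Proof.
move=> /complexI /powR_eq0_eq0 /eqP.
rewrite psumr_eq0 => [|i _]; last exact: powR_ge0.
move=> /allP x0; apply/matrixP => i j; rewrite ord1 mxE.
have /implyP/(_ isT)/eqP/powR_eq0_eq0 := x0 i (mem_index_enum i).
exact: eq0_normc.
Qed.

HB.instance Definition _ := @Lmodule_isNormed.Build R[i] V
  nrm ellp_normD ellp_normZ ellp_norm_eq0.

End Structure.

Section T2.
Variables (p : R) (p1 : 1 <= p).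
Local Notation L := (bop (ellp p1 2) (ellp p1 2)).

Definition strict_upper_pred : {pred L} := [pred f : L |
  `[< exists z : R[i], forall x : 'cV[R[i]]_2,
        f x = (z *: delta_mx 0 1 : 'M[R[i]]_2) *m x >]].

Fact strict_upper_submod : submod_closed strict_upper_pred.
Proof.
split.
  by apply/asboolP; exists 0 => x; rewrite scale0r mul0mx.
move=> c f g /asboolP[z fz] /asboolP[w gw]; apply/asboolP.
exists (c * z + w) => x.
by rewrite scalerDl mulmxDl -scalerA -scalemxAl -fz -gw.
Qed.

Fact strict_upper_mul :
  {in strict_upper_pred &, forall x y, amul x y \in strict_upper_pred}.
Proof.
move=> f g /asboolP[z fz] /asboolP[w gw]; apply/asboolP.
exists 0 => x; rewrite [LHS]fz gw mulmxA -scalemxAl -scalemxAr.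
by rewrite mul_delta_mx_0// !scaler0 scale0r.
Qed.

Definition T2_subalgebra : subalgebra L :=
  Subalgebra strict_upper_submod strict_upper_mul.

Definition T2 : normedAlgType R[i] := subalg T2_subalgebra.

End T2.

End FiniteSequences.

(* The complex version of the library's LspaceType: measurable functions
   f : T -> R[i] such that |f|^q is integrable, modulo equality almost
   everywhere. *)
Section Lebesgue.
Context d {T : measurableType d} {R : realType}.
Variables (mu : {measure set T -> \bar R}) (q : R) (q1 : 1 <= q).

Let q_ge0 : 0 <= q := le_trans ler01 q1.
Let q1e : (1 <= q%:E)%E. Proof. by rewrite lee_fin. Qed.

(* Measurability for the Borel sigma-algebra of the complex plane. *)
Definition cmeasurable (f : T -> R[i]) : Prop :=
  measurable_fun setT (fun x => complex.Re (f x)) /\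
  measurable_fun setT (fun x => complex.Im (f x)).

(* The argument 1 <= q is only there to index the submodule instance. *)
Definition cLfun (_ : 1 <= q) : {pred T -> R[i]} := [pred f : T -> R[i] |
  `[< cmeasurable f /\ finite_norm mu q%:E (fun x => normc (f x)) >]].

Let N (f : T -> R[i]) : \bar R :=
  'N[mu]_(q%:E)[EFin \o (fun x => normc (f x))]%E.

Fact cmeasurableD (f g : T -> R[i]) :
  cmeasurable f -> cmeasurable g -> cmeasurable (f + g).
Proof.
move=> [fr fi] [gr gi]; split.
- rewrite (_ : (fun x => _) = fun x => complex.Re (f x) + complex.Re (g x)).
    exact: measurable_funD.
  by apply/funext => x; rewrite !fctE; case: (f x) (g x) => ? ? [].
- rewrite (_ : (fun x => _) = fun x => complex.Im (f x) + complex.Im (g x)).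
    exact: measurable_funD.
  by apply/funext => x; rewrite !fctE; case: (f x) (g x) => ? ? [].
Qed.

Fact cmeasurableZ (c : R[i]) (f : T -> R[i]) :
  cmeasurable f -> cmeasurable (c *: f).
Proof.
move=> [fr fi]; split.
- rewrite (_ : (fun x => _) = fun x => complex.Re c * complex.Re (f x) -
      complex.Im c * complex.Im (f x)).
    by apply: measurable_funB; apply: measurable_funM.
  by apply/funext => x; rewrite !fctE; case: c (f x) => ? ? [].
- rewrite (_ : (fun x => _) = fun x => complex.Re c * complex.Im (f x) +
      complex.Im c * complex.Re (f x)).
    by apply: measurable_funD; apply: measurable_funM.
  by apply/funext => x; rewrite !fctE; case: c (f x) => ? ? [].
Qed.

Fact measurable_normc (f : T -> R[i]) : cmeasurable f ->
  measurable_fun setT (fun x => normc (f x)).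
Proof.
move=> [mre mim].
rewrite (_ : (fun x => _) = fun x =>
    (complex.Re (f x) ^+ 2 + complex.Im (f x) ^+ 2) `^ 2^-1).
  apply: (@measurableT_comp _ _ _ _ _ _ (@powR R ^~ 2^-1)) => //.
  by apply: measurable_funD; apply: measurable_funX.
apply/funext => x; rewrite powR12_sqrt ?addr_ge0 ?sqr_ge0//.
by case: (f x).
Qed.

Fact normc_Lfun (f : T -> R[i]) : f \in cLfun q1 ->
  (fun x => normc (f x)) \in Lfun mu q%:E.
Proof.
move=> fL; apply/andP; split; apply: mem_set; last by case/asboolP : fL.
by apply: measurable_normc; case/asboolP : fL.
Qed.

Fact measurable_norm_powR (f : T -> R) : measurable_fun setT f ->
  measurable_fun setT (fun x => (`|f x| `^ q)%:E).
Proof.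
move=> mf; apply/measurable_EFinP.
apply: (@measurableT_comp _ _ _ _ _ _ (@powR R ^~ q)) => //.
exact: measurableT_comp.
Qed.

Fact le_N (f g : T -> R) : measurable_fun setT f -> measurable_fun setT g ->
  (forall x, 0 <= f x <= g x) ->
  ('N[mu]_(q%:E)[EFin \o f] <= 'N[mu]_(q%:E)[EFin \o g])%E.
Proof.
move=> mf mg fg; rewrite unlock; apply: gt0_ler_poweR.
- by rewrite invr_ge0.
- by rewrite in_itv/= leey andbT integral_ge0.
- by rewrite in_itv/= leey andbT integral_ge0.
apply: ge0_le_integral => //.
- by move=> x _; rewrite lee_fin powR_ge0.
- exact: measurable_norm_powR.
- exact: measurable_norm_powR.
move=> x _; have /andP[f0 fgx] := fg x.
rewrite /= lee_fin; apply: ge0_ler_powR; rewrite ?nnegrE//.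
by rewrite !ger0_norm// (le_trans f0).
Qed.

Fact le_ND (f g : T -> R[i]) : cmeasurable f -> cmeasurable g ->
  (N (f + g)%R <= N f + N g)%E.
Proof.
move=> fL gL; apply: le_trans (minkowski_EFin mu (measurable_normc fL)
  (measurable_normc gL) q1).
apply: le_N => [||x]; last by rewrite normc_ge0 le_normcD.
- exact: measurable_normc (cmeasurableD fL gL).
- by apply: measurable_funD; exact: measurable_normc.
Qed.

Fact NZ (c : R[i]) (f : T -> R[i]) : f \in cLfun q1 ->
  N (c *: f) = ((normc c)%:E * N f)%E.
Proof.
move=> fL; have := LnormZ (Lfun_Sub q1e (normc_Lfun fL)) (normc c).
rewrite ger0_norm ?normc_ge0// => <-.
by apply: eq_Lnorm => x /=; rewrite normcM.
Qed.

Fact cLfun_submod : submod_closed (cLfun q1).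
Proof.
split.
  apply/asboolP; split; first by split; exact: measurable_cst.
  have := finite_norm_cst0 mu q1e; congr (finite_norm _ _ _).
  by apply/funext => x; rewrite /= expr0n/= addr0 sqrtr0.
move=> c f g fL /asboolP[mg gN].
have /asboolP[mf fN] := fL.
apply/asboolP; split; first exact: cmeasurableD (cmeasurableZ _ _) _.
apply: (le_lt_trans (le_ND (cmeasurableZ c mf) mg)).
by rewrite lte_add_pinfty// NZ// lte_mul_pinfty// lee_fin normc_ge0.
Qed.

HB.instance Definition _ := GRing.isSubmodClosed.Build R[i] (T -> R[i])
  (cLfun q1) cLfun_submod.

Record LfunC := MkLfunC {LfunC_fun :> T -> R[i]; LfunCP : LfunC_fun \in cLfun q1}.

HB.instance Definition _ := [isSub for LfunC_fun].
HB.instance Definition _ := [Choice of LfunC by <:].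
HB.instance Definition _ := [SubChoice_isSubLmodule of LfunC by <:].

Fact LfunC_cmeasurable (f : LfunC) : cmeasurable f.
Proof. by have /asboolP[] := LfunCP f. Qed.

Definition LfunC_aeeq : rel LfunC :=
  fun f g => `[< (f : T -> R[i]) = g %[ae mu] >].

Fact LfunC_aeeq_refl : reflexive LfunC_aeeq.
Proof. by move=> f; apply/asboolP; exact: ae_eq_refl. Qed.
Fact LfunC_aeeq_sym : symmetric LfunC_aeeq.
Proof. by move=> f g; apply/asboolP/asboolP => /ae_eq_sym. Qed.
Fact LfunC_aeeq_trans : transitive LfunC_aeeq.
Proof.
by move=> f g h /asboolP gf /asboolP fh; apply/asboolP/(ae_eq_trans gf fh).
Qed.

Canonical LfunC_aeeq_equiv :=
  EquivRel LfunC_aeeq LfunC_aeeq_refl LfunC_aeeq_sym LfunC_aeeq_trans.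

Local Open Scope quotient_scope.

Definition LspaceC : Type := {eq_quot LfunC_aeeq}.

HB.instance Definition _ := Choice.on LspaceC.
HB.instance Definition _ := EqQuotient.on LspaceC.

Let cls (f : LfunC) : LspaceC := \pi_LspaceC f.

Let clsE (f g : LfunC) : (f : T -> R[i]) = g %[ae mu] -> cls f = cls g.
Proof. by move=> fg; apply/eqmodP/asboolP. Qed.

Let repr_cls (f : LfunC) : (repr (cls f) : T -> R[i]) = f %[ae mu].
Proof. by have /eqmodP/asboolP := reprK (cls f). Qed.

Let clsW (P : LspaceC -> Prop) : (forall f, P (cls f)) -> forall x, P x.
Proof. by move=> Pc x; rewrite -(reprK x); exact: Pc. Qed.

Definition LspaceC_add (x y : LspaceC) := cls (repr x + repr y).
Definition LspaceC_opp (x : LspaceC) := cls (- repr x).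
Definition LspaceC_scale (c : R[i]) (x : LspaceC) := cls (c *: repr x).

Let add_cls (f g : LfunC) : LspaceC_add (cls f) (cls g) = cls (f + g).
Proof.
apply: clsE; apply: filterS2 (repr_cls f) (repr_cls g) => x fx gx _.
by rewrite -[LHS]/(repr (cls f) x + repr (cls g) x) (fx I) (gx I).
Qed.

Let opp_cls (f : LfunC) : LspaceC_opp (cls f) = cls (- f).
Proof.
apply: clsE; apply: filterS (repr_cls f) => x fx _.
by rewrite -[LHS]/(- repr (cls f) x) (fx I).
Qed.

Let scale_cls c (f : LfunC) : LspaceC_scale c (cls f) = cls (c *: f).
Proof.
apply: clsE; apply: filterS (repr_cls f) => x fx _.
by rewrite -[LHS]/(c *: repr (cls f) x) (fx I).
Qed.

Fact LspaceC_addA : associative LspaceC_add.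
Proof.
elim/clsW => f; elim/clsW => g; elim/clsW => h.
by rewrite !add_cls addrA.
Qed.
Fact LspaceC_addC : commutative LspaceC_add.
Proof. by elim/clsW => f; elim/clsW => g; rewrite !add_cls addrC. Qed.
Fact LspaceC_add0 : left_id (cls 0) LspaceC_add.
Proof. by elim/clsW => f; rewrite add_cls add0r. Qed.
Fact LspaceC_addN : left_inverse (cls 0) LspaceC_opp LspaceC_add.
Proof. by elim/clsW => f; rewrite opp_cls add_cls addNr. Qed.

HB.instance Definition _ := GRing.isZmodule.Build LspaceC
  LspaceC_addA LspaceC_addC LspaceC_add0 LspaceC_addN.

Let addE (f g : LfunC) : cls f + cls g = cls (f + g).
Proof. exact: add_cls. Qed.

Fact LspaceC_scaleA a b x :
  LspaceC_scale a (LspaceC_scale b x) = LspaceC_scale (a * b) x.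
Proof. by elim/clsW: x => f; rewrite !scale_cls scalerA. Qed.
Fact LspaceC_scale1 : left_id 1 LspaceC_scale.
Proof. by elim/clsW => f; rewrite !scale_cls scale1r. Qed.
Fact LspaceC_scaleDr : right_distributive LspaceC_scale +%R.
Proof.
move=> c; elim/clsW => f; elim/clsW => g.
by rewrite addE !scale_cls addE scalerDr.
Qed.
Fact LspaceC_scaleDl x : {morph LspaceC_scale^~ x : a b / a + b}.
Proof.
by elim/clsW: x => f a b; rewrite !scale_cls addE scalerDl.
Qed.

HB.instance Definition _ := GRing.Zmodule_isLmodule.Build R[i] LspaceC
  LspaceC_scaleA LspaceC_scale1 LspaceC_scaleDr LspaceC_scaleDl.

Definition LspaceC_norm (x : LspaceC) : R := fine (N (repr x)).

Let nrm (x : LspaceC) : R[i] := (LspaceC_norm x)%:C.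

Let N_fin (f : LfunC) : (fine (N f))%:E = N f.
Proof. exact: (finite_norm_fine (Lfun_Sub q1e (normc_Lfun (LfunCP f)))). Qed.

Let norm_cls (f : LfunC) : LspaceC_norm (cls f) = fine (N f).
Proof.
congr fine; rewrite /N unlock; congr (_ `^ _)%E.
apply: ae_eq_integral => //.
- apply/measurable_EFinP; apply: (@measurableT_comp _ _ _ _ _ _ (@powR R ^~ q)) => //.
  by apply: measurableT_comp => //; exact: measurable_normc (LfunC_cmeasurable _).
- apply/measurable_EFinP; apply: (@measurableT_comp _ _ _ _ _ _ (@powR R ^~ q)) => //.
  by apply: measurableT_comp => //; exact: measurable_normc (LfunC_cmeasurable _).
- apply: filterS (repr_cls f) => x fx _.
  exact: (congr1 (fun z : R[i] => (`|normc z| `^ q)%:E) (fx I)).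
Qed.

Fact LspaceC_normD x y : nrm (x + y) <= nrm x + nrm y.
Proof.
elim/clsW: x => f; elim/clsW: y => g; rewrite /nrm -rmorphD lecR.
rewrite addE !norm_cls -lee_fin EFinD !N_fin.
exact: le_ND (LfunC_cmeasurable f) (LfunC_cmeasurable g).
Qed.

Fact LspaceC_normZ (c : R[i]) x : nrm (c *: x) = `|c| * nrm x.
Proof.
elim/clsW: x => f; rewrite [`|c|](_ : _ = (normc c)%:C)// /nrm -rmorphM.
congr (_%:C); rewrite [c *: _]scale_cls !norm_cls; apply: EFin_inj.
by rewrite EFinM !N_fin; exact: NZ (LfunCP f).
Qed.

Fact LspaceC_norm_eq0 x : nrm x = 0 -> x = 0.
Proof.
elim/clsW: x => f /complexI; rewrite norm_cls.
move=> /(fine_Lnormr_eq0 (f := Lfun_Sub q1e (normc_Lfun (LfunCP f)))) f0.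
by apply: clsE; apply: filterS f0 => x /(_ I) /eq0_normc.
Qed.

HB.instance Definition _ := @Lmodule_isNormed.Build R[i] LspaceC
  nrm LspaceC_normD LspaceC_normZ LspaceC_norm_eq0.

End Lebesgue.

Section Representations.
Context {R : realType}.
Implicit Types A B : normedAlgType R[i].

Definition isometrically_isomorphic A B : Prop :=
  exists phi : {linear A -> B},
    [/\ bijective phi, {morph phi : a b / amul a b} & forall a, `|phi a| = `|a|].

Definition representation A (E : normedModType R[i])
    (pi : {linear A -> bop E E}) : Prop :=
  continuous pi /\ {morph pi : a b / amul a b}.

Definition isometric_representation A (E : normedModType R[i])
    (pi : {linear A -> bop E E}) : Prop :=
  representation pi /\ forall a, `|pi a| = `|a|.

Definition nondegenerate A (E : normedModType R[i])
    (pi : {linear A -> bop E E}) : Prop :=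
  dense [set v : E | exists (n : nat) (c : 'I_n -> R[i]) (a : 'I_n -> A)
    (x : 'I_n -> E), v = \sum_(i < n) c i *: pi (a i) (x i)].

Definition Lq_operator_algebra (q : R) (q1 : 1 <= q) A : Prop :=
  exists (d : measure_display) (T : measurableType d)
    (mu : {measure set T -> \bar R}),
    exists pi : {linear A -> bop (LspaceC mu q1) (LspaceC mu q1)},
      isometric_representation pi.

Definition nondegenerately_representable A (E : normedModType R[i]) : Prop :=
  exists pi : {linear A -> bop E E},
    isometric_representation pi /\ nondegenerate pi.

End Representations.

(* Main.v *)
(* The algebra T2 is spanned by one element and has zero product, so the
   multiplier identities hold trivially and a multiplier is any pair of linear
   maps of a line, i.e. a pair of scalars; both maps have as norm the modulus
   of their scalar. To represent C^2 isometrically on E it is enough to have a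
   nontrivial projection P with |a P x + b (1 - P) x| <= max(|a|, |b|) |x|: the
   first coordinate projection on l^q_2, or the restriction to a set which,
   like its complement, has positive measure on L^q. *)
From HB Require Import structures.
Require Import Defs.
From mathcomp Require Import all_boot all_order all_algebra.
From mathcomp Require Import all_classical all_reals all_analysis.
From mathcomp Require Import measurable_realfun complex.

Set Implicit Arguments.
Unset Strict Implicit.
Unset Printing Implicit Defensive.
Import Order.TTheory GRing.Theory Num.Theory.
Import numFieldNormedType.Exports.
Import Normc.

Local Open Scope complex_scope.
Local Open Scope ring_scope.

(** * Bounds for product and operator norms *)

Lemma prod_norm_le (K : numFieldType) (A B : normedModType K) (x : A * B) (r : K) :
  (`|x| <= r) = (`|x.1| <= r) && (`|x.2| <= r).
Proof. by rewrite prod_normE comparable_ge_max ?real_comparable. Qed.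

(** A complex [c] with [0 <= c] is real, so it can be compared with the real supremum defining the
    norm. *)
Lemma bop_norm_le (R : realType) (E F : normedModType R[i]) (f : bop E F) (c : R[i]) :
  0 <= c -> (forall x, `|f x| <= c * `|x|) -> `|f| <= c.
Proof.
move=> c0 fc; rewrite -[c]RRe_real ?ger0_real// [leLHS]/((opnorm f)%:C) lecR.
apply: opnorm_le => x x1; rewrite rnorm_le RRe_real ?ger0_real//.
rewrite (le_trans (fc x))// ler_piMr//.
by rewrite rnorm_le in x1.
Qed.

(** * Multipliers of a line with zero product *)

Section OneDimensional.
Context {R : realType} (A : normedAlgType R[i]) (e : A) (k : A -> R[i]).
Hypotheses (e0 : e != 0) (kE : forall x, x = k x *: e)
  (mul0 : forall x y : A, amul x y = 0).

Definition bop_scalar (f : bop A A) : R[i]^o := k (f e).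

Lemma bop_scalarE (f : bop A A) x : f x = bop_scalar f *: x.
Proof.
by rewrite {1}(kE x) linearZ/= (kE (f e)) scalerA mulrC -scalerA -kE.
Qed.

(** As [k] is not assumed linear, the algebraic properties of [bop_scalar] come from this
    uniqueness, which rests on [e != 0]. *)
Lemma bop_scalar_uniq (f : bop A A) (c : R[i]) : f e = c *: e -> bop_scalar f = c.
Proof.
move=> fc; apply/eqP; rewrite -subr_eq0; apply: contraTT e0 => cf.
by rewrite -[e](scalerK cf) scalerBl -bop_scalarE fc subrr scaler0 eqxx.
Qed.

Lemma bop_scalar_is_linear : linear bop_scalar.
Proof.
move=> c f g; apply: bop_scalar_uniq.
by rewrite scalerDl -scalerA -!bop_scalarE.
Qed.

(** Evaluating at the nonzero [e] bounds the scalar by the norm; the converse holds because [f] acts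
    as that scalar everywhere. *)
Lemma norm_bop_scalar (f : bop A A) : `|bop_scalar f| = `|f|.
Proof.
apply/le_anti/andP; split.
  by have := opnormP f e; rewrite bop_scalarE normrZ ler_pM2r ?normr_gt0.
by apply: bop_norm_le => // x; rewrite bop_scalarE normrZ.
Qed.

Lemma bop_scalar_comp (f g : bop A A) :
  bop_scalar (bop_comp f g) = bop_scalar f * bop_scalar g.
Proof. by apply: bop_scalar_uniq; rewrite /= !bop_scalarE scalerA. Qed.

Definition mult_coefs (m : multiplier_algebra A) : (R[i]^o * R[i]^o)%type :=
  (bop_scalar (val m).1, bop_scalar (val m).2).

Lemma mult_coefs_is_linear : linear mult_coefs.
Proof.
by move=> c m n; rewrite /mult_coefs !raddfD !linearZ/= !bop_scalar_is_linear.
Qed.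

HB.instance Definition _ :=
  GRing.isLinear.Build _ _ _ _ mult_coefs mult_coefs_is_linear.

Fact id_bounded_linear : (id : A -> A) \in bounded_linear.
Proof. by apply/asboolP; split => //; exists 1 => x; rewrite mul1r. Qed.

Definition id_bop : bop A A := Bop id_bounded_linear.

(** Gives surjectivity of [mult_coefs]: with zero products, both sides of each multiplier identity
    vanish. *)
Fact scalar_multiplier (c : R[i] * R[i]) : (c.1 *: id_bop, c.2 *: id_bop) \in
  subalg_pred (multiplier_subalgebra A).
Proof.
apply/asboolP => a b.
rewrite [(_, _).1]/= [(_, _).2]/= !mul0 /=.
by split=> //; exact: (scaler0 _).
Qed.

Lemma mult_coefs_bij : bijective mult_coefs.
Proof.
exists (fun c => Subalg (scalar_multiplier c)) => [m|[c d]].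
  apply: val_inj; rewrite [RHS]surjective_pairing.
  by congr pair; apply: bopE => x; rewrite [RHS]bop_scalarE.
by congr pair; apply: bop_scalar_uniq.
Qed.

Lemma mult_coefsM : {morph mult_coefs : a b / amul a b}.
Proof.
move=> [[L S] ?] [[L' S'] ?]; congr pair; first exact: bop_scalar_comp.
(* The second component lies in the opposite algebra, so its scalars come out in reverse order and
   must be commuted. *)
exact: etrans (bop_scalar_comp S' S) (mulrC _ _).
Qed.

Lemma norm_mult_coefs m : `|mult_coefs m| = `|m|.
Proof.
have -> : `|m| = `|val m| by [].
by rewrite !prod_normE !norm_bop_scalar.
Qed.

Lemma mult_coefs_iso :
  isometrically_isomorphic (multiplier_algebra A) (R[i]^o * R[i]^o)%type.
Proof.
exists mult_coefs; split.
- exact: mult_coefs_bij.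
- exact: mult_coefsM.
- exact: norm_mult_coefs.
Qed.

End OneDimensional.

Lemma isometric_continuous (K : numFieldType) (V W : normedModType K)
  (f : {linear V -> W}) : (forall x, `|f x| = `|x|) -> continuous f.
Proof.
move=> fN x; apply/cvgrPdist_lt => r r0.
near=> y; rewrite -raddfB fN; near: y.
exact: (cvgrPdist_lt _ _).1 cvg_id _ r0.
Unshelve. all: by end_near. Qed.

(** * Isometric representations of C^2 from a projection *)

Section TwoBlocks.
Context {R : realType} (E : normedModType R[i]) (P : {linear E -> E}).
(** An arbitrary common bound [M] avoids a maximum in the partially ordered [R[i]]; taking [M] to be
    the norm of the pair bounds the operator [blocks]. *)
Hypotheses (PP : forall x, P (P x) = P x)
  (P_le : forall (a b M : R[i]) x, `|a| <= M -> `|b| <= M ->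
    `|a *: P x + b *: (x - P x)| <= M * `|x|).
Local Notation C2 := (R[i]^o * R[i]^o)%type.

Definition blocks_fun (ab : C2) (x : E) : E := ab.1 *: P x + ab.2 *: (x - P x).

Lemma norm_blocks_fun ab x : `|blocks_fun ab x| <= `|ab| * `|x|.
Proof.
have /andP[aM bM] : (`|ab.1| <= `|ab|) && (`|ab.2| <= `|ab|).
  by rewrite -prod_norm_le.
exact: P_le.
Qed.

Fact blocks_bounded_linear ab : blocks_fun ab \in bounded_linear.
Proof.
apply/asboolP; split.
  move=> c x y; rewrite /blocks_fun linearP opprD addrACA -scalerBr.
  by rewrite !scalerDr !scalerA ![_ * c]mulrC -!scalerA addrACA -scalerDr.
by exists (rnorm ab) => x; rewrite -rnormE; exact: norm_blocks_fun.
Qed.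

Definition blocks ab : bop E E := Bop (blocks_bounded_linear ab).

Lemma blocks_is_linear : linear blocks.
Proof.
move=> c ab ab'; apply: bopE => x.
rewrite [RHS]/(c *: blocks_fun ab x + blocks_fun ab' x) /= /blocks_fun.
by rewrite !scalerDl -!scalerA addrACA -scalerDr.
Qed.

HB.instance Definition _ :=
  GRing.isLinear.Build _ _ _ _ blocks blocks_is_linear.

(** With [compl_P_blocks], this shows that [P] and its complement diagonalise [blocks ab], whence
    multiplicativity. *)
Lemma P_blocks ab x : P (blocks ab x) = ab.1 *: P x.
Proof.
by rewrite linearD !linearZ/= linearB/= PP subrr scaler0 addr0.
Qed.

Lemma compl_P_blocks ab x : blocks ab x - P (blocks ab x) = ab.2 *: (x - P x).
Proof.
by rewrite P_blocks [blocks ab x]/(ab.1 *: P x + ab.2 *: (x - P x)) addrC addKr.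
Qed.

Lemma blocks_comp ab ab' x :
  blocks_fun ab (blocks ab' x) = blocks_fun (amul ab ab') x.
Proof. by rewrite /blocks_fun compl_P_blocks P_blocks !scalerA. Qed.

Lemma blocksM : {morph blocks : ab ab' / amul ab ab'}.
Proof. by move=> ab ab'; apply: bopE => x; rewrite [RHS]blocks_comp. Qed.

Lemma blocks1 x : blocks (1, 1) x = x.
Proof. by rewrite /= /blocks_fun/= !scale1r addrC subrK. Qed.

Context (u v : E) (u0 : u != 0) (v0 : v != 0) (Pu : P u = u) (Pv : P v = 0).

(** The lower bound uses that [u] and [v] are eigenvectors, with eigenvalues [ab.1] and [ab.2]. *)
Lemma norm_blocks ab : `|blocks ab| = `|ab|.
Proof.
apply/le_anti/andP; split.
  by apply: bop_norm_le => // x; exact: norm_blocks_fun.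
rewrite prod_norm_le; apply/andP; split.
  have := opnormP (blocks ab) u.
  rewrite /= /blocks_fun Pu subrr scaler0 addr0.
  by rewrite normrZ ler_pM2r ?normr_gt0.
have := opnormP (blocks ab) v.
rewrite /= /blocks_fun Pv subr0 scaler0 add0r.
by rewrite normrZ ler_pM2r ?normr_gt0.
Qed.

Lemma nondegenerately_representable_blocks (A : normedAlgType R[i]) :
  isometrically_isomorphic A C2 ->
  nondegenerately_representable A E.
Proof.
move=> [phi [[psi phiK psiK] phiM phiN]].
have piN a : `|(blocks \o phi) a| = `|a| by rewrite /= norm_blocks phiN.
exists (blocks \o phi); split.
  split=> //; split; first exact: isometric_continuous.
  by move=> a b; rewrite /= phiM blocksM.
(* The unit (1, 1) acts as the identity, so every vector of [E] already lies in the span. *)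
move=> O [x Ox] _; exists x; split=> //.
exists 1%N, (fun=> 1), (fun=> psi (1, 1)), (fun=> x).
have pi1 : blocks (phi (psi (1, 1))) = blocks (1, 1) by congr blocks; exact: psiK.
by rewrite big_ord1 scale1r [bop_fun _ _](congr1 (fun f : bop E E => f x) pi1) blocks1.
Qed.

End TwoBlocks.

(** * Coordinatewise estimates in l^p *)

Section EllP.
Context {R : realType} {p : R} (p1 : 1 <= p) (d : nat).
Local Notation V := (ellp p1 d).

Lemma ellp_norm_le (x y : V) (M : R) : 0 <= M ->
  (forall i, normc (x i ord0) <= M * normc (y i ord0)) ->
  `|x| <= M%:C * `|y|.
Proof.
move=> M0 xy; have p0 : 0 < p := lt_le_trans ltr01 p1.
rewrite -[`|x|]/((ellp_norm x)%:C) -[`|y|]/((ellp_norm y)%:C) -rmorphM lecR.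
(* Writing M as (M^p)^(1/p) moves it under the outer root, leaving a termwise comparison of sums. *)
rewrite -{1}[M]powRr1// -(mulfV (lt0r_neq0 p0)) powRrM.
rewrite -powRM ?powR_ge0//; last by apply: sumr_ge0 => i _; exact: powR_ge0.
apply: ge0_ler_powR; rewrite ?invr_ge0 ?nnegrE ?(ltW p0)//.
- by apply: sumr_ge0 => i _; exact: powR_ge0.
- by rewrite mulr_ge0 ?powR_ge0// sumr_ge0// => i _; exact: powR_ge0.
rewrite mulr_sumr; apply: ler_sum => i _.
rewrite -powRM ?normc_ge0//; apply: ge0_ler_powR; rewrite ?nnegrE ?(ltW p0)//.
- exact: normc_ge0.
- by rewrite mulr_ge0 ?normc_ge0.
Qed.

Lemma coord_le_ellp_norm (x : V) i : normc (x i ord0) <= ellp_norm x.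
Proof.
have p0 : 0 < p := lt_le_trans ltr01 p1.
rewrite -[leLHS](powRr1 (normc_ge0 _)) -{1}(mulfV (lt0r_neq0 p0)) powRrM.
apply: ge0_ler_powR; rewrite ?invr_ge0 ?nnegrE ?powR_ge0 ?(ltW p0)//.
  by apply: sumr_ge0 => j _; exact: powR_ge0.
rewrite (bigD1 i)//= lerDl; apply: sumr_ge0 => j _; exact: powR_ge0.
Qed.

End EllP.

(** * The algebra of strictly upper triangular matrices *)

Section MultipliersOfT2.
Context {R : realType} {p : R} (p1 : 1 <= p).
Local Notation V := (ellp p1 2).

Definition shift_fun (x : V) : V := (delta_mx 0 1 : 'M[R[i]]_2) *m x.

Lemma shift_funE x : shift_fun x = x 1 0 *: (delta_mx 0 0 : V).
Proof.
apply/matrixP => i j; rewrite !mxE (bigD1 1)//= big1 ?addr0 => [|k k1].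
  by rewrite !mxE eqxx andbT mulrC ord1 eqxx andbT.
by rewrite mxE (negPf k1) andbF mul0r.
Qed.

Lemma shift_fun_delta : shift_fun (delta_mx 1 0) = delta_mx 0 0 :> 'cV[R[i]]_2.
Proof. by rewrite /shift_fun mul_delta_mx. Qed.

Fact shift_bounded_linear : shift_fun \in bounded_linear.
Proof.
apply/asboolP; split.
  by move=> c x y; rewrite /shift_fun mulmxDr -scalemxAr.
(* The image of [x] is its second coordinate times the first basis vector, so the norm of that
   vector serves as the constant without being computed. *)
exists (rnorm (delta_mx 0 0 : V)) => x.
rewrite shift_funE normrZ -rnormE mulrC ler_wpM2l//.
rewrite -[`|x 1 0|]/((normc (x 1 0))%:C) lecR.
exact: coord_le_ellp_norm.
Qed.

Definition shift : bop V V := Bop shift_bounded_linear.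

Fact shift_mem : shift \in subalg_pred (T2_subalgebra p1).
Proof. by apply/asboolP; exists 1 => x; rewrite scale1r. Qed.

Definition T2_shift : T2 p1 := Subalg shift_mem.

Lemma T2_shift_neq0 : T2_shift != 0.
Proof.
apply/eqP => /(congr1 (fun f : T2 p1 => (val f : V -> V) (delta_mx 1 0) 0 0)).
rewrite [LHS]/(shift_fun _ 0 0) shift_fun_delta [LHS]mxE mxE => /eqP.
by rewrite !eqxx oner_eq0.
Qed.

(** Applying the matrix to the second basis vector exposes its upper right entry z; this is the
    coordinate function [k] on the line. *)
Definition T2_coord (f : T2 p1) : R[i] := (val f : V -> V) (delta_mx 1 0) 0 0.

Lemma T2_coordE f : f = T2_coord f *: T2_shift.
Proof.
have /asboolP[z fz] := valP f.
have -> : T2_coord f = z.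
  by rewrite /T2_coord fz -scalemxAl mul_delta_mx !mxE mulr1.
apply: val_inj; apply: bopE => x.
by rewrite fz -scalemxAl.
Qed.

Lemma T2_mul0 (f g : T2 p1) : amul f g = 0.
Proof.
have /asboolP[z fz] := valP f; have /asboolP[w gw] := valP g.
apply: val_inj; apply: bopE => x; rewrite [LHS]fz gw mulmxA.
by rewrite -scalemxAl -scalemxAr mul_delta_mx_0// !scaler0 mul0mx.
Qed.

Lemma multiplier_T2_iso :
  isometrically_isomorphic (multiplier_algebra (T2 p1)) (R[i]^o * R[i]^o)%type.
Proof. exact: mult_coefs_iso T2_shift_neq0 T2_coordE T2_mul0. Qed.

End MultipliersOfT2.

(** * The first coordinate projection on l^q_2 *)

Section EllP2.
Context {R : realType} {q : R} (q1 : 1 <= q).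
Local Notation V := (ellp q1 2).

Definition first_coord (x : V) : V := diag_mx (delta_mx 0 0) *m x.

Lemma first_coord_is_linear : linear first_coord.
Proof. by move=> c x y; rewrite /first_coord mulmxDr -scalemxAr. Qed.

HB.instance Definition _ :=
  GRing.isLinear.Build _ _ _ _ first_coord first_coord_is_linear.

Lemma first_coordE (x : V) i j : first_coord x i j = if i == 0 then x i j else 0.
Proof.
rewrite /first_coord mul_diag_mx !mxE.
by case: (i == 0); rewrite ?mul1r ?mul0r.
Qed.

Lemma first_coordK x : first_coord (first_coord x) = first_coord x.
Proof. by apply/matrixP => i j; rewrite !first_coordE; case: (i == 0). Qed.

(** The combination multiplies coordinate 0 of [x] by [a] and the other by [b], so coordinatewise
    domination applies. *)
Lemma first_coord_le (a b M : R[i]) x : `|a| <= M -> `|b| <= M ->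
  `|a *: first_coord x + b *: (x - first_coord x)| <= M * `|x|.
Proof.
move=> aM bM; have M0 := le_trans (normr_ge0 a) aM.
(* [M] dominates a modulus, hence is real; [ellp_norm_le] takes a real constant. *)
have ME : M = (complex.Re M)%:C by rewrite RRe_real// ger0_real.
rewrite ME in aM bM M0 *; apply: ellp_norm_le => [|i].
  by rewrite lecR in M0.
rewrite [X in normc X](_ : _ = a * first_coord x i ord0 +
  b * (x i ord0 - first_coord x i ord0)); last by rewrite !mxE.
rewrite first_coordE; case: eqP => _.
  rewrite subrr mulr0 addr0 normcM ler_wpM2r ?normc_ge0//.
  by rewrite lecR in aM.
rewrite subr0 mulr0 add0r normcM ler_wpM2r ?normc_ge0//.
by rewrite lecR in bM.
Qed.

Lemma nondegenerately_representable_ellp2 (A : normedAlgType R[i]) :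
  isometrically_isomorphic A (R[i]^o * R[i]^o)%type ->
  nondegenerately_representable A V.
Proof.
apply: (nondegenerately_representable_blocks first_coordK first_coord_le
  (u := delta_mx 0 0) (v := delta_mx 1 0)).
- apply/eqP => /matrixP /(_ 0 0) /eqP.
  by rewrite !mxE oner_eq0.
- apply/eqP => /matrixP /(_ 1 0) /eqP.
  by rewrite !mxE oner_eq0.
- by apply/matrixP => i j; rewrite first_coordE !mxE; case: eqP.
- by apply/matrixP => i j; rewrite first_coordE !mxE; case: eqP => // ->.
Qed.

End EllP2.

(** * Restriction to a measurable set on complex L^q *)

Section Restriction.
Context d {T : measurableType d} {R : realType} (mu : {measure set T -> \bar R}).
Context (q : R) (q1 : 1 <= q) (D : set T) (mD : measurable D).
Local Notation Lq := (LspaceC mu q1).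
Local Notation N f := ('N[mu]_q%:E [EFin \o (fun x => normc (f x))])%E.

Definition lclass (f : LfunC mu q1) : Lq := (\pi_Lq f)%qT.

Lemma lclass_eq (f g : LfunC mu q1) : (f : T -> R[i]) = g %[ae mu] <-> lclass f = lclass g.
Proof.
split=> [fg|]; first by apply/eqmodP/asboolP.
by move=> /eqmodP/asboolP.
Qed.

Lemma repr_lclass (f : LfunC mu q1) : (repr (lclass f) : T -> R[i]) = f %[ae mu].
Proof. by apply/lclass_eq; rewrite /lclass reprK. Qed.

Lemma lclassW (S : Lq -> Prop) : (forall f, S (lclass f)) -> forall x, S x.
Proof. by move=> Sc x; rewrite -(reprK x); exact: Sc. Qed.

Lemma lclass_is_linear : linear lclass.
Proof.
move=> c f g; apply/esym/lclass_eq.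
(* Scaling and addition each choose representatives, so three almost everywhere equalities are
   combined. *)
apply: filterS3 (repr_lclass (c *: repr (lclass f))) (repr_lclass f)
  (repr_lclass g) => t cfE fE gE _.
rewrite -[LHS]/(repr (lclass (c *: repr (lclass f))) t + repr (lclass g) t).
by rewrite (cfE I) (gE I) -[RHS]/(c * f t + g t) -(fE I).
Qed.

HB.instance Definition _ :=
  GRing.isLinear.Build _ _ _ _ lclass lclass_is_linear.

Lemma measurable_normc_powR (f : LfunC mu q1) :
  measurable_fun setT (fun t => (`|normc (f t)| `^ q)%:E : \bar R).
Proof.
exact: measurable_norm_powR (measurable_normc (LfunC_cmeasurable f)).
Qed.

Lemma Lnorm_fin (f : LfunC mu q1) : (N f \is a fin_num)%E.
Proof.
rewrite ge0_fin_numE ?Lnorm_ge0//.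
by have /asboolP[] := LfunCP f.
Qed.

(** The norm is defined through a chosen representative, but integrands equal almost everywhere have
    equal integrals. *)
Lemma norm_lclass (f : LfunC mu q1) : `|lclass f| = (fine (N f))%:C.
Proof.
rewrite [LHS]/((LspaceC_norm _)%:C) /LspaceC_norm; congr (fine _)%:C.
rewrite unlock; congr (_ `^ _)%E; apply: ae_eq_integral => //.
- exact: measurable_normc_powR.
- exact: measurable_normc_powR.
- apply: filterS (repr_lclass f) => t ft _.
  exact: (congr1 (fun z : R[i] => (`|normc z| `^ q)%:E) (ft I)).
Qed.

Lemma lclass_norm_le (f g : LfunC mu q1) (M : R) : 0 <= M ->
  (forall t, normc (f t) <= M * normc (g t)) -> `|lclass f| <= M%:C * `|lclass g|.
Proof.
move=> M0 fg; rewrite !norm_lclass -rmorphM lecR.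
rewrite -lee_fin EFinM !fineK ?Lnorm_fin//.
(* Homogeneity absorbs the constant into the function, so that monotonicity of the seminorm
   concludes. *)
have -> : (M%:E * N g = N (M%:C *: (g : T -> R[i])))%E.
  rewrite NZ ?LfunCP//; congr (_%:E * _)%E.
  by rewrite /= expr0n addr0 sqrtr_sqr ger0_norm.
apply: le_N => // [||t].
- exact: measurable_normc (LfunC_cmeasurable f).
- exact: measurable_normc (LfunC_cmeasurable (M%:C *: g)).
rewrite normc_ge0 (le_trans (fg t))// [leRHS]normcM.
by rewrite /= expr0n addr0 sqrtr_sqr ger0_norm.
Qed.

Fact Lfun_restrict_subproof (f : LfunC mu q1) :
  (fun t => \1_D t * f t) \in cLfun mu q1.
Proof.
have [fr fi] := LfunC_cmeasurable f.
have mDf : cmeasurable (fun t => \1_D t * f t).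
  split.
  - rewrite (_ : (fun t => _) = fun t => \1_D t * complex.Re (f t)).
      exact: measurable_funM.
    apply/funext => t; rewrite !indicE; case: (t \in D); case: (f t) => x y.
      by rewrite !mul1r.
    by rewrite !mul0r.
  - rewrite (_ : (fun t => _) = fun t => \1_D t * complex.Im (f t)).
      exact: measurable_funM.
    apply/funext => t; rewrite !indicE; case: (t \in D); case: (f t) => x y.
      by rewrite !mul1r.
    by rewrite !mul0r.
apply/asboolP; split=> //.
have /asboolP[_] := LfunCP f; apply: le_lt_trans.
apply: le_N => // [||t].
- exact: measurable_normc.
- exact: measurable_normc (LfunC_cmeasurable f).
rewrite normc_ge0 normcM ler_piMl ?normc_ge0// indicE.
by case: (t \in D); rewrite /= ?expr0n ?expr1n addr0 ?sqrtr1 ?sqrtr0.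
Qed.

Definition Lfun_restrict f : LfunC mu q1 := MkLfunC (Lfun_restrict_subproof f).

Definition lrestrict (x : Lq) : Lq := lclass (Lfun_restrict (repr x)).

(** Independence of the representative: linearity and idempotence then reduce to pointwise
    identities. *)
Lemma lrestrict_lclass f : lrestrict (lclass f) = lclass (Lfun_restrict f).
Proof.
apply/lclass_eq; apply: filterS (repr_lclass f) => t fE _.
by rewrite /= (fE I).
Qed.

Lemma lrestrict_is_linear : linear lrestrict.
Proof.
move=> c; elim/lclassW => f; elim/lclassW => g.
rewrite -linearP !lrestrict_lclass -linearP; congr lclass.
apply: val_inj; apply/funext => t.
have E (x y z : R[i]) : x * (c * y + z) = c * (x * y) + x * z.
  by rewrite mulrDr mulrCA.
exact: E.
Qed.

HB.instance Definition _ :=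
  GRing.isLinear.Build _ _ _ _ lrestrict lrestrict_is_linear.

Lemma indic_idem t : \1_D t * \1_D t = \1_D t :> R[i].
Proof. by rewrite indicE; case: (t \in D); rewrite ?mulr1 ?mulr0. Qed.

Lemma lrestrictK x : lrestrict (lrestrict x) = lrestrict x.
Proof.
elim/lclassW: x => f; rewrite !lrestrict_lclass; congr lclass.
by apply: val_inj; apply/funext => t; rewrite /= mulrA indic_idem.
Qed.

Lemma lrestrict_le (a b M : R[i]) x : `|a| <= M -> `|b| <= M ->
  `|a *: lrestrict x + b *: (x - lrestrict x)| <= M * `|x|.
Proof.
move=> aM bM; have M0 := le_trans (normr_ge0 a) aM.
have ME : M = (complex.Re M)%:C by rewrite RRe_real// ger0_real.
rewrite ME in aM bM M0 *; elim/lclassW: x => f.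
rewrite lrestrict_lclass -linearB -!linearZ -linearD.
rewrite lecR in M0; rewrite lecR in aM; rewrite lecR in bM.
(* Here [s] stands for the membership of a point in [D]: the function is multiplied by [a] on [D]
   and by [b] off it. *)
have E (s : bool) (z : R[i]) :
    normc (a * (s%:R * z) + b * (z - s%:R * z)) <= complex.Re M * normc z.
  case: s; rewrite ?mul1r ?mul0r ?subrr ?subr0 mulr0 ?addr0 ?add0r normcM;
  by rewrite ler_wpM2r ?normc_ge0.
by apply: lclass_norm_le => // t; exact: E.
Qed.

(** Finiteness puts the constant 1 in L^q; the other two make the indicators of [D] and its
    complement nonzero classes. *)
Hypotheses (mu_fin : (mu setT < +oo)%E) (muD : mu D != 0) (muDC : mu (~` D)%classic != 0).

Fact Lfun_one_subproof : (cst 1 : T -> R[i]) \in cLfun mu q1.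
Proof.
apply/asboolP; split; first by split; exact: measurable_cst.
rewrite /finite_norm (eq_Lnorm _ _ (g := cst 1%E)) => [|t].
  by rewrite Lnorm_cst1; exact: poweR_lty.
by rewrite /= expr1n expr0n addr0 sqrtr1.
Qed.

Definition Lfun_one : LfunC mu q1 := MkLfunC Lfun_one_subproof.

(** If the class vanishes, [A] lies in the exceptional null set. The contrapositive shows that
    indicators of sets of nonzero measure are nonzero in L^q. *)
Lemma measure0_lclass0 (f : LfunC mu q1) (A : set T) : measurable A ->
  (forall t, A t -> f t != 0) -> lclass f = 0 -> mu A = 0.
Proof.
move=> mA Af; rewrite -(linear0 lclass) => /lclass_eq f0.
apply: measure_negligible => //.
apply: negligibleS f0 => t At /(_ I) ft.
by move/eqP: (Af t At).
Qed.

Lemma Lq_operator_algebra_split (A : normedAlgType R[i]) :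
  isometrically_isomorphic A (R[i]^o * R[i]^o)%type ->
  Lq_operator_algebra q1 A.
Proof.
have uD t : D t -> Lfun_restrict Lfun_one t != 0.
  by move=> Dt; rewrite /= indicE mem_set// mul1r oner_eq0.
have vD t : (~` D)%classic t -> (Lfun_one - Lfun_restrict Lfun_one) t != 0.
  move=> Dt; suff -> : (Lfun_one - Lfun_restrict Lfun_one) t = 1 by exact: oner_neq0.
  have E : \1_D t = 0 :> R[i] by rewrite indicE memNset.
  have -> : (Lfun_one - Lfun_restrict Lfun_one) t = 1 - \1_D t * 1 :> R[i] by [].
  by rewrite E mul0r subr0.
have PP : lrestrict (lclass (Lfun_restrict Lfun_one)) = lclass (Lfun_restrict Lfun_one).
  by rewrite -lrestrict_lclass lrestrictK.
(* The eigenvectors are the indicator of [D], fixed by restriction, and 1 minus it, which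
   restriction kills. *)
move=> iso; have [] := nondegenerately_representable_blocks lrestrictK
  lrestrict_le (u := lclass (Lfun_restrict Lfun_one)) (v := lclass (Lfun_one - Lfun_restrict Lfun_one))
  _ _ _ _ iso.
- by apply: contraNneq muD => /(measure0_lclass0 mD uD) ->.
- by apply: contraNneq muDC => /(measure0_lclass0 (measurableC mD) vD) ->.
- exact: PP.
- by rewrite linearB/= linearB/= PP lrestrict_lclass subrr.
by move=> pi [piI _]; exists d, T, mu, pi.
Qed.

End Restriction.

(** * The two-point measure space and the conclusion *)

Lemma Lq_operator_algebra_C2 (R : realType) (q : R) (q1 : 1 <= q)
  (A : normedAlgType R[i]) :
  isometrically_isomorphic A (R[i]^o * R[i]^o)%type ->
  Lq_operator_algebra q1 A.
Proof.
(* This is counting measure on two points, the simplest finite measure with a set and its complement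
   both of nonzero measure. *)
pose mu : {measure set bool -> \bar R} := measure_add (dirac true) (dirac false).
have muE S : mu S = (((true \in S)%:R + (false \in S)%:R)%:E)%E.
  by rewrite EFinD; exact: measure_addE.
apply: (@Lq_operator_algebra_split _ _ _ mu _ _ [set true]%classic) => //.
- by rewrite muE ltry.
- rewrite muE mem_set// memNset//.
  by rewrite addr0 eqe oner_eq0.
- rewrite muE memNset => [|/(_ erefl)//]; rewrite mem_set//.
  by rewrite add0r eqe oner_eq0.
Qed.

Theorem theorem4p2 (R : realType) :
  (forall (p : R) (p1 : 1 <= p),
     isometrically_isomorphic (multiplier_algebra (T2 p1))
       (R[i]^o * R[i]^o)%type)
  /\
  (forall (p q : R) (p1 : 1 <= p) (q1 : 1 <= q),
     Lq_operator_algebra q1 (multiplier_algebra (T2 p1)) /\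
     nondegenerately_representable (multiplier_algebra (T2 p1)) (ellp q1 2)).
Proof.
split=> [p p1|p q p1 q1]; first exact: multiplier_T2_iso.
split; first exact/Lq_operator_algebra_C2/multiplier_T2_iso.
exact/nondegenerately_representable_ellp2/multiplier_T2_iso.
Qed.
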